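(* Let $p=\big((x_1,y_1),(x_2,y_2)\big)$ be a pair of points of $(0,1)^2$ with $x_1<x_2$ and $y_2<y_1$, and let $T=Z_p$ be the zipper map of parameter $p$. Assume that $T$ is hypersensitive, i.e. $\min\big(\frac{y_1}{x_1},\frac{y_1-y_2}{x_2-x_1},\frac{1-y_2}{1-x_2}\big)>1$, and that at least one of the following holds: (1) $x_1+x_2=y_1+y_2=1$; or (2) $y_1^2>y_2$ and $y_1>(2-y_2)y_2$. Then for all positive integers $k,\ell$ and every strict total order $\prec$ on a family of pairwise distinct symbols $(s_i^j)_{1\le i\le k,\ 0\le j\le \ell}$, there exist points $z_1,\dots,z_k\in[0,1]$ such that for all $i,i'\in\{1,\dots,k\}$ and all $j,j'\in\{0,\dots,\ell\}$: \[ s_i^j\prec s_{i'}^{j'} \iff T^j(z_i)<T^{j'}(z_{i'}).\]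
   Context: Let $\mathscr{C}^0_0$ be the set of continuous maps $f:[0,1]\to[0,1]$ with $f(0)=0$ and $f(1)=1$, with the uniform distance. For $p=\big((x_1,y_1),(x_2,y_2)\big)$ with both points in $(0,1)^2$, $x_1<x_2$, $y_2<y_1$, let $\Phi_p:\mathscr{C}^0_0\to\mathscr{C}^0_0$ be defined by: $\Phi_pf(x)=y_1 f\big(\frac{x}{x_1}\big)$ if $x\in[0,x_1]$; $\Phi_pf(x)=y_1-(y_1-y_2)f\big(\frac{x-x_1}{x_2-x_1}\big)$ if $x\in[x_1,x_2]$; $\Phi_pf(x)=y_2+(1-y_2)f\big(\frac{x-x_2}{1-x_2}\big)$ if $x\in[x_2,1]$. The map $\Phi_p$ is a contraction in the uniform norm; the zipper map $Z_p\in\mathscr{C}^0_0$ of parameter $p$ is its unique fixed point. $T^j$ denotes the $j$-th iterate of $T$. *)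

(* Defs.v *)
From mathcomp Require Import all_boot all_order all_algebra.
From mathcomp Require Import all_classical all_reals all_analysis.
Set Implicit Arguments.
Unset Strict Implicit.
Unset Printing Implicit Defensive.
Import Order.TTheory GRing.Theory Num.Theory.
Import numFieldNormedType.Exports.
Local Open Scope classical_set_scope.
Local Open Scope ring_scope.

(* A map [0,1] -> [0,1] is represented by a total function R -> R of which only
   the restriction to [0,1] matters: its values elsewhere are unconstrained. *)
Definition C00 (R : realType) : set (R -> R) :=
  [set f : R -> R | [/\ {within `[0, 1], continuous f},
               forall x, 0 <= x <= 1 -> 0 <= f x <= 1,
               f 0 = 0 & f 1 = 1]].

(* The three closed pieces overlap at x1 and x2, where the formulas agree as
   soon as f 0 = 0 and f 1 = 1; the values outside [0,1] are junk. *)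
Definition zipper_op (R : realType) (p : (R * R) * (R * R)) (f : R -> R) :
    R -> R :=
  let: ((x1, y1), (x2, y2)) := p in
  fun x =>
    if x <= x1 then y1 * f (x / x1)
    else if x <= x2 then y1 - (y1 - y2) * f ((x - x1) / (x2 - x1))
    else y2 + (1 - y2) * f ((x - x2) / (1 - x2)).

(* The operator is a contraction of C00 for the uniform distance, so it has
   exactly one fixed point there, as a map on [0,1]. *)
Definition is_zipper_map (R : realType) (p : (R * R) * (R * R)) (T : R -> R) :
    Prop :=
  C00 T /\ (forall x, 0 <= x <= 1 -> zipper_op p T x = T x).

Definition strict_total_order (S : eqType) (prec : rel S) : Prop :=
  [/\ irreflexive prec, transitive prec &
      forall a b : S, a != b -> prec a b || prec b a].

(* Main.v *)
(** If an interval K carries N inverse branches of T, all mapping K into K and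
    with ordered images, then every order on N symbols is realized: pull a point
    of K back along its orbit, using at time j the branch whose index is the rank
    of the symbol s_i^j. To obtain such a K, call (u, h, v, g) a copy when
    T (u + h t) = v + g T t on [0, 1]. By the self-similarity of T a suitable
    level b has, for every N, at least N ordered inverse branches over one
    neighbourhood of b, and hypersensitivity makes h / g arbitrarily small, so
    that the diagonal looks like a horizontal line in a small copy. If that line
    sits near level b, the base interval of the copy is the desired K. In case
    (1) take b = 1/2 and the iterates of the middle copy; in case (2) every level
    in (0, 1) will do, and b is a limit of levels at which the diagonal meets
    small copies. *)

Require Import Defs.
From mathcomp Require Import all_boot all_order all_algebra.
From mathcomp Require Import all_classical all_reals all_analysis.
From mathcomp Require Import ring lra.
Set Implicit Arguments.
Unset Strict Implicit.
Unset Printing Implicit Defensive.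
Import Order.TTheory GRing.Theory Num.Theory.
Import numFieldNormedType.Exports.
Local Open Scope classical_set_scope.
Local Open Scope ring_scope.

(** * Orders realized by ordered inverse branches *)

(** The rank counts predecessors. The two facts are paired by [prod], so that together they serve as
    a rewriting rule. *)
Lemma strict_total_order_rank (S : finType) (prec : rel S) :
  strict_total_order prec ->
  exists r : S -> nat, forall a b, ((r a < #|S|)%N * (prec a b = (r a < r b)%N)).
Proof.
case=> irr tr tot.
have mono a b : prec a b ->
    (#|[pred c | prec c a]| < #|[pred c | prec c b]|)%N.
  move=> ab; apply/proper_card/properP; split.
    by apply/fintype.subsetP => c; rewrite !inE => /tr; apply.
  by exists a; rewrite !inE // irr.
exists (fun a => #|[pred c | prec c a]|) => a b; split.
  apply/proper_card/properP; split; first by apply/fintype.subsetP.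
  by exists a; rewrite !inE // irr.
apply/idP/idP => [/mono//|]; apply: contraTT => nab.
have [->|/tot/orP[|/mono]] := eqVneq a b; first by rewrite ltnn.
  by rewrite (negPf nab).
by rewrite -leqNgt => /ltnW.
Qed.

(** The arguments [y] and [y'] are independent, so whole images are separated: orbit points are
    compared by branch index alone. *)
Definition ordered_branches (R : realType) (T : R -> R) (N : nat)
    (I V : set R) : Prop :=
  exists f : nat -> R -> R,
    (forall i y, (i < N)%N -> V y -> I (f i y) /\ T (f i y) = y) /\
    (forall i j y y', (i < j < N)%N -> V y -> V y' -> f i y < f j y').

Lemma ordered_branches_sub (R : realType) (T : R -> R) N (I I' V V' : set R) :
  I `<=` I' -> V' `<=` V ->
  ordered_branches T N I V -> ordered_branches T N I' V'.
Proof.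
move=> II' VV' [f [fT flt]]; exists f; split.
  by move=> i y iN /VV' Vy; have [/II' ? ?] := fT _ _ iN Vy.
by move=> i j y y' ij /VV' Vy /VV' Vy'; exact: flt.
Qed.

(** The shifted itinerary is realized first; its point is then pulled back by the branch [w 0]. *)
Lemma ordered_branches_orbit (R : realType) (T : R -> R) N (K : set R)
    (f : nat -> R -> R) (y0 : R) :
  K y0 -> (forall i y, (i < N)%N -> K y -> K (f i y) /\ T (f i y) = y) ->
  forall (l : nat) (w : nat -> nat), (forall j, (w j < N)%N) ->
  exists2 z, K z & forall j, (j <= l)%N ->
    exists2 y, K y & iter j T z = f (w j) y.
Proof.
move=> Ky0 fT; elim=> [|l IH] w wN.
  exists (f (w 0%N) y0); first by have [] := fT _ _ (wN 0%N) Ky0.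
  by move=> j; rewrite leqn0 => /eqP ->; exists y0.
have [z Kz zP] := IH (fun j => w j.+1) (fun j => wN j.+1).
have [Kfz Tfz] := fT _ _ (wN 0%N) Kz.
exists (f (w 0%N) z) => // -[_|j jl]; first by exists z.
by rewrite iterSr Tfz; exact: zP.
Qed.

Lemma orders_of_ordered_branches (R : realType) (T : R -> R) (K : set R)
    (k l : nat) (prec : rel ('I_k * 'I_l.+1)) :
  strict_total_order prec -> K !=set0 ->
  ordered_branches T (k * l.+1) K K ->
  exists z : 'I_k -> R, (forall i, K (z i)) /\
    (forall i i' (j j' : 'I_l.+1),
       prec (i, j) (i', j') <-> iter j T (z i) < iter j' T (z i')).
Proof.
move=> hprec [y0 Ky0] [f [fT flt]].
have [r rP] := strict_total_order_rank hprec.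
have rN a : (r a < k * l.+1)%N.
  by have [] := rP a a; rewrite card_prod !card_ord.
have /choice[z zP] (i : 'I_k) : exists z, K z /\ forall j : 'I_l.+1,
    exists2 y, K y & iter j T z = f (r (i, j)) y.
  have [z Kz zP] := ordered_branches_orbit Ky0 fT l
    (fun j => rN (i, inord j)).
  exists z; split => // j; have [y Ky ->] := zP j (ltn_ord j).
  by exists y => //; rewrite inord_val.
exists z; split; first by move=> i; case: (zP i).
have lt i i' (j j' : 'I_l.+1) : prec (i, j) (i', j') ->
    iter j T (z i) < iter j' T (z i').
  rewrite rP; have [_ /(_ j)[y Ky ->]] := zP i.
  have [_ /(_ j')[y' Ky' ->]] := zP i' => rr.
  by apply: flt => //; rewrite rr rN.
move=> i i' j j'; split=> [|ltT]; first exact: lt.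
have [_ _ tot] := hprec.
have [[ei ej]|/tot/orP[//|/lt/(lt_trans ltT)]] := eqVneq (i, j) (i', j').
  by move: ltT; rewrite ei ej ltxx.
by rewrite ltxx.
Qed.

(** * Affine copies and renormalization of levels *)

Definition affine_copy (R : realType) (T : R -> R) (u h v g : R) : Prop :=
  [/\ 0 < h, 0 <= u, u + h <= 1 &
      forall t, 0 <= t <= 1 -> T (u + h * t) = v + g * T t].

Lemma affine_copy_comp (R : realType) (T : R -> R) (u h v g u' h' v' g' : R) :
  affine_copy T u h v g -> affine_copy T u' h' v' g' ->
  affine_copy T (u + h * u') (h * h') (v + g * v') (g * g').
Proof.
move=> [h0 u0 uh1 cT] [h'0 u'0 uh'1 cT']; split; first exact: mulr_gt0.
- by rewrite addr_ge0 // mulr_ge0 // ltW.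
- by nra.
- move=> t t01; have -> : u + h * u' + h * h' * t = u + h * (u' + h' * t) by ring.
  by rewrite cT ?cT'; [ring | | nra].
Qed.

Definition multiplicity_ge (R : realType) (T : R -> R) (N : nat) (b : R) :=
  exists2 e, 0 < e &
    ordered_branches T N [set x | 0 <= x <= 1] [set y | `|y - b| <= e].

(** The branches are conjugated by the copy. Their order survives a negative [g], since [h] is
    positive and the separation holds for unrelated arguments. *)
Lemma ordered_branches_copy (R : realType) (T : R -> R) (u h v g b e : R) N :
  affine_copy T u h v g -> g != 0 ->
  ordered_branches T N [set x | 0 <= x <= 1] [set y | `|y - b| <= e] ->
  ordered_branches T N [set x | u <= x <= u + h]
    [set y | `|(y - v) / g - b| <= e].
Proof.
move=> [h0 u0 uh1 cT] g0 [f [fT flt]].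
exists (fun i y => u + h * f i ((y - v) / g)); split => [i y iN|i j y y' ij] /= Vy.
  have [/andP[f0 f1] Tf] := fT i _ iN Vy; split.
    by rewrite lerDl mulr_ge0 ?(ltW h0)//= lerD2l ler_piMr ?(ltW h0).
  by rewrite cT ?f0// Tf mulrC divfK// addrC subrK.
by move=> Vy'; rewrite ltrD2l ltr_pM2l//; exact: flt.
Qed.

Lemma copy_values_nbhs (R : realType) (v g b e : R) : 0 < e -> g != 0 ->
  exists2 d, 0 < d &
    [set y | `|y - b| <= d] `<=` [set y | `|(y - v) / g - (b - v) / g| <= e].
Proof.
move=> e0 g0; exists (e * `|g|) => [|y /=]; first by rewrite mulr_gt0 ?normr_gt0.
by rewrite -mulrBl opprB addrA subrK normrM normfV ler_pdivrMr ?normr_gt0.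
Qed.

Lemma multiplicity_ge_copy (R : realType) (T : R -> R) (u h v g b : R) N :
  affine_copy T u h v g -> g != 0 ->
  multiplicity_ge T N ((b - v) / g) -> multiplicity_ge T N b.
Proof.
move=> cp g0 [e e0 /(ordered_branches_copy cp g0) br].
have [d d0 sub] := copy_values_nbhs v b e0 g0; exists d => //.
apply: ordered_branches_sub sub br => x /= xI.
by case: cp => ? ? ? _; lra.
Qed.

(* A copy much flatter than T near a level of high multiplicity gives
   a horseshoe on its own base interval. *)
Lemma horseshoe_of_copies (R : realType) (T : R -> R) (b : R) N :
  multiplicity_ge T N b ->
  (forall e, 0 < e -> exists u h v g, [/\ affine_copy T u h v g, g != 0 &
     forall t, 0 <= t <= 1 -> `|(u + h * t - v) / g - b| <= e]) ->
  exists K : set R, [/\ K !=set0, K `<=` [set x | 0 <= x <= 1] &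
    ordered_branches T N K K].
Proof.
move=> [e e0 br] /(_ e e0)[u [h [v [g [cp g0 close]]]]].
have [h0 u0 uh1 _] := cp.
exists [set x | u <= x <= u + h]; split; first by exists u; rewrite /=; lra.
  by move=> x /= ?; lra.
apply: ordered_branches_sub (ordered_branches_copy cp g0 br) => // x /= xI.
have -> : x = u + h * ((x - u) / h) by field; rewrite gt_eqF.
apply: close; rewrite divr_ge0 ?ler_pdivrMr//=; lra.
Qed.

Lemma C00_preimage (R : realType) (T : R -> R) (c y : R) :
  C00 T -> 0 <= c <= 1 -> 0 <= y <= T c -> exists x, 0 <= x <= c /\ T x = y.
Proof.
move=> [ct _ T0 _] /andP[c0 c1] /andP[y0 yT].
have ctc : {within `[0, c], continuous T}.
  by apply: continuous_subspaceW ct; apply: subset_itvl; rewrite bnd_simp.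
have [|x] := IVT c0 ctc (v := y).
  by rewrite T0 ge_min le_max y0 yT orbT.
by rewrite in_itv /= => xc Tx; exists x.
Qed.

(* One more branch is found to the left of the copy, where T climbs from 0
   to v; it avoids the base point u because b is not equal to v. *)
Lemma multiplicity_ge_succ (R : realType) (T : R -> R) (u h v g b : R) N :
  C00 T -> affine_copy T u h v g -> g != 0 -> 0 < b < v ->
  multiplicity_ge T N ((b - v) / g) -> multiplicity_ge T N.+1 b.
Proof.
move=> CT cp g0 /andP[b0 bv] [e e0 /(ordered_branches_copy cp g0) br].
have [d d0 sub] := copy_values_nbhs v b e0 g0.
have [f [fT flt]] := ordered_branches_sub (@subset_refl _ _) sub br.
have [h0 u0 uh1 cT] := cp; have [_ _ T0 _] := CT.
have Tu : T u = v by have := cT 0; rewrite T0 !mulr0 !addr0; apply; rewrite lexx ler01.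
pose d' := Num.min d (Num.min (b / 2) ((v - b) / 2)).
have [dd [db dv]] : d' <= d /\ d' <= b / 2 /\ d' <= (v - b) / 2.
  by rewrite /d' !ge_min !lexx !orbT.
have d'0 : 0 < d' by rewrite /d' !lt_min d0 /=; lra.
have close y : `|y - b| <= d' -> `|y - b| <= d /\ 0 < y < v.
  by move=> yb; split; [exact: le_trans dd|move: yb; rewrite ler_norml; lra].
have /choice[f0 f0P] y : exists x, `|y - b| <= d' -> 0 <= x < u /\ T x = y.
  have [yb|nyb] := pselect (`|y - b| <= d'); last by exists 0 => /nyb.
  have [_ yv] := close _ yb.
  have [| |x [xu Tx]] := @C00_preimage _ T u y CT; [lra|rewrite Tu; lra|].
  exists x => _; split=> //; rewrite lt_neqAle andbCA xu andbT.
  by apply/eqP => xu'; move: yv; rewrite -Tx xu' Tu ltxx andbF.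
exists d' => //; exists (fun i => if i is j.+1 then f j else f0); split=> /=.
  move=> [|i] y iN yb; first by have [? ->] := f0P _ yb; split => //; lra.
  by have [/= ? ->] := fT i y iN (close _ yb).1; split => //; lra.
move=> [|i] [|j] y y' //= jN yb y'b; last first.
  exact: flt jN (close _ yb).1 (close _ y'b).1.
have [? _] := f0P _ yb; have [/= ? _] := fT j y' jN (close _ y'b).1.
lra.
Qed.

Lemma multiplicity_ge0 (R : realType) (T : R -> R) (b : R) : multiplicity_ge T 0 b.
Proof.
by exists 1 => //; exists (fun=> id); split=> // i j y y'; rewrite ltn0 andbF.
Qed.

(** * Zipper maps: copies, multiplicities and flat copies *)

Lemma is_zipper_map_copies (R : realType) (x1 y1 x2 y2 : R) (T : R -> R) :
  0 < x1 -> x1 < x2 -> x2 < 1 -> is_zipper_map ((x1, y1), (x2, y2)) T ->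
  [/\ affine_copy T 0 x1 0 y1, affine_copy T x1 (x2 - x1) y1 (y2 - y1)
    & affine_copy T x2 (1 - x2) y2 (1 - y2)].
Proof.
move=> x10 x12 x21 [[_ _ T0 T1] TE]; split; split; try lra; move=> t t01.
- rewrite -TE; last by nra.
  rewrite !add0r /= ifT ?ler_piMr//; try lra.
  by rewrite [x1 * t]mulrC mulfK // gt_eqF.
- rewrite -TE /=; last by nra.
  (* At [t = 0] the point is [x1], which [zipper_op] assigns to the first piece. *)
  have [t0|t0] := eqVneq t 0.
    by rewrite t0 mulr0 addr0 lexx divff ?gt_eqF// T1 T0; ring.
  have t_gt0 : 0 < t by rewrite lt_neqAle eq_sym t0; lra.
  rewrite ifF; last by apply/negbTE; rewrite -ltNge; nra.
  rewrite ifT; last by nra.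
  have -> : (x1 + (x2 - x1) * t - x1) / (x2 - x1) = t.
    by field; lra.
  by ring.
- rewrite -TE /=; last by nra.
  rewrite ifF; last by apply/negbTE; rewrite -ltNge; nra.
  have [t0|t0] := eqVneq t 0.
    by rewrite t0 mulr0 addr0 lexx divff ?T1 ?T0; [ring|lra].
  have t_gt0 : 0 < t by rewrite lt_neqAle eq_sym t0; lra.
  rewrite ifF; last by apply/negbTE; rewrite -ltNge; nra.
  have -> : (x2 + (1 - x2) * t - x2) / (1 - x2) = t.
    by field; lra.
  by ring.
Qed.

Lemma exp_lt_small (R : realType) (q e : R) : 0 <= q -> q < 1 -> 0 < e ->
  exists n, q ^+ n < e.
Proof.
move=> q0 q1 e0; have /cvgrPdist_lt/(_ e e0)[n _ /(_ n (leqnn n))] :=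
  @cvg_expr R q ltac:(by rewrite ger0_norm).
by rewrite sub0r normrN => /(le_lt_trans (ler_norm _)); exists n.
Qed.

(* Under y2 < y1^2 levels below y2 are renormalized by b |-> b / y1, which
   cannot jump over the interval (y2, y1); the last condition does the same
   from above, through b |-> (b - y2) / (1 - y2). *)
Lemma zipper_multiplicity (R : realType) (x1 y1 x2 y2 : R) (T : R -> R) N b :
  C00 T -> affine_copy T 0 x1 0 y1 ->
  affine_copy T x1 (x2 - x1) y1 (y2 - y1) ->
  affine_copy T x2 (1 - x2) y2 (1 - y2) ->
  0 < y2 -> y2 < y1 -> y1 < 1 -> y2 < y1 ^+ 2 -> (2 - y2) * y2 < y1 ->
  0 < b < 1 -> multiplicity_ge T N b.
Proof.
move=> CT cp1 cp2 cp3 y20 y21 y11 c1 c2; elim: N b => [|N IH] b b01.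
  exact: multiplicity_ge0.
(* The middle copy turns [c] into [(y1 - c) / (y1 - y2)], again in (0, 1), where [IH] applies. *)
have mid c : y2 < c < y1 -> multiplicity_ge T N.+1 c.
  move=> cy; apply: (multiplicity_ge_succ CT cp2); [by rewrite lt_eqF; lra|lra|].
  apply: IH; rewrite -mulrNN -invrN !opprB.
  by rewrite divr_gt0 ?ltr_pdivrMr ?mul1r; lra.
have low n c : y2 * y1 ^+ n < c < y1 -> multiplicity_ge T N.+1 c.
  elim: n c => [|n IHn] c; first by rewrite expr0 mulr1; exact: mid.
  rewrite exprS mulrCA => cn.
  have [cy2|] := ltP y2 c; first by apply: mid; lra.
  move=> cy2; apply: (multiplicity_ge_copy cp1); first by lra.
  rewrite subr0; apply: IHn; rewrite ltr_pdivlMr; last lra.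
  by rewrite mulrC; case/andP: cn => -> _ /=; rewrite ltr_pdivrMr; nra.
(* [c2] amounts to [1 - y1 < (1 - y2) ^+ 2], the mirror image of [c1]. *)
have high n c : (1 - y1) * (1 - y2) ^+ n < 1 - c < 1 - y2 -> multiplicity_ge T N.+1 c.
  elim: n c => [|n IHn] c; first by rewrite expr0 mulr1 => ?; apply: mid; lra.
  rewrite exprS mulrCA => cn.
  have [cy1|] := ltP c y1; first by apply: mid; lra.
  move=> cy1; apply: (multiplicity_ge_copy cp3); first by lra.
  have E : 1 - (c - y2) / (1 - y2) = (1 - c) / (1 - y2) by field; lra.
  apply: IHn; rewrite E ltr_pdivlMr; last lra.
  by rewrite mulrC; case/andP: cn => -> _ /=; rewrite ltr_pdivrMr; nra.
have [by1|by1] := ltP b y1.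
  have [|||n] := @exp_lt_small R y1 (b / y2); [lra|lra|by rewrite divr_gt0; lra|].
  by rewrite ltr_pdivlMr // mulrC => yn; apply: (low n); rewrite yn.
have [|||n] := @exp_lt_small R (1 - y2) ((1 - b) / (1 - y1)).
- lra.
- lra.
- by rewrite divr_gt0; lra.
by rewrite ltr_pdivlMr ?subr_gt0 // mulrC => yn; apply: (high n); rewrite yn /=; lra.
Qed.

(* Inside the decreasing copy over [x1, x2] the diagonal is a line of slope
   -h / g, starting at a level at least d and ending at a level at most 1 - d.
   The left or the right third keeps these bounds: when the left one fails, the
   diagonal is too high at x1 to drop to y2 before x2, its slope being small. *)
Lemma zipper_flat_copies (R : realType) (x1 y1 x2 y2 : R) (T : R -> R) :
  affine_copy T 0 x1 0 y1 ->
  affine_copy T x1 (x2 - x1) y1 (y2 - y1) ->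
  affine_copy T x2 (1 - x2) y2 (1 - y2) ->
  0 < y2 -> y1 < 1 -> x1 < y1 -> x2 - x1 < y1 - y2 -> y2 < x2 ->
  exists2 d, 0 < d & forall e, 0 < e -> exists u h v g,
    [/\ affine_copy T u h v (- g), 0 < g, h <= e * g, g * d <= v - u &
        v - (u + h) <= g * (1 - d)].
Proof.
move=> cp1 cp2 cp3 y20 y11 xy1 xy12 xy2.
have [x10 _ x11 _] := cp1; have [x120 _ _ _] := cp2; have [x20 _ _ _] := cp3.
(* The first two terms give both bounds for the middle copy, where the induction starts; the third
   leaves a margin [2 * d] for the right third. *)
pose d := Num.min (y1 - x1) (Num.min (x2 - y2) ((y1 - y2 - (x2 - x1)) / 2)).
have [d1 [d2 d3]] : d <= y1 - x1 /\ d <= x2 - y2 /\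
    d <= (y1 - y2 - (x2 - x1)) / 2.
  by rewrite /d !ge_min !lexx !orbT.
have d0 : 0 < d by rewrite /d !lt_min; lra.
clearbody d.
pose q := Num.max (x1 / y1) ((1 - x2) / (1 - y2)).
have q0 : 0 <= q by rewrite /q le_max divr_ge0; lra.
have q1 : q < 1 by rewrite /q gt_max !ltr_pdivrMr ?mul1r; lra.
have q_le : x1 <= q * y1 /\ 1 - x2 <= q * (1 - y2).
  by split; rewrite -ler_pdivrMr /q ?le_max ?lexx ?orbT//; lra.
exists d => // e e0.
have [n qn] := exp_lt_small q0 q1 e0.
(* Only the increasing outer thirds are composed, so the copies stay decreasing, and each step
   multiplies [h / g] by at most [q]. The bound [h <= g] is carried along for [P1]. *)
suff [u [h [v [g [[cp g0 hg hg1] [lo hi]]]]]] : exists u h v g,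
    [/\ affine_copy T u h v (- g), 0 < g, h <= q ^+ n * g & h <= g] /\
    g * d <= v - u /\ v - (u + h) <= g * (1 - d).
  exists u, h, v, g; split=> //.
  by apply: le_trans hg _; rewrite ler_pM2r // ltW.
elim: n {qn} => [|n [u [h [v [g [[cp g0 hg hg1] [lo hi]]]]]]].
  exists x1, (x2 - x1), y1, (y1 - y2); rewrite opprB expr0 mul1r.
  by split; [split|split] => //; nra.
have [h0 u0 uh1 _] := cp.
have qn0 : 0 <= q ^+ n by exact: exprn_ge0.
have gd0 : 0 <= g * d by rewrite mulr_ge0; lra.
have [left|right] := leP (v - (u + h * x1)) (g * y1 * (1 - d)).
  exists u, (h * x1), v, (g * y1); split; split.
  - by have := affine_copy_comp cp cp1; rewrite !mulr0 !addr0 mulNr.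
  - by rewrite mulr_gt0 //; lra.
  - by rewrite exprSr mulrACA; apply: ler_pM; [lra|lra|exact: hg|]; exact: q_le.1.
  - by apply: ler_pM; lra.
  - by rewrite mulrAC; apply: le_trans lo; apply: ler_piMr; lra.
  - exact: left.
(* [P1] to [P3] yield the lower bound for the right third, [P4] the upper one. *)
have P1 : 0 <= (g - h) * (x2 - x1) by rewrite mulr_ge0; lra.
have P2 : 0 <= g * (y1 - y2 - (x2 - x1) - 2 * d) by rewrite mulr_ge0; lra.
have P3 : 0 <= g * d * (1 - y1 + y2) by rewrite mulr_ge0; lra.
have P4 : 0 <= g * d * y2 by rewrite mulr_ge0; lra.
exists (u + h * x2), (h * (1 - x2)), (v + - g * y2), (g * (1 - y2)); split; split.
- by rewrite -[- (g * _)]mulNr; exact: affine_copy_comp cp cp3.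
- by rewrite mulr_gt0 //; lra.
- by rewrite exprSr mulrACA; apply: ler_pM; [lra|lra|exact: hg|exact: q_le.2].
- by apply: ler_pM; lra.
- by lra.
- by lra.
Qed.

(** By compactness the starting levels [(v - u) / g] of ever flatter copies cluster at some [b];
    along each copy the level moves by at most [h / g]. *)
Lemma zipper_crossing_level (R : realType) (x1 y1 x2 y2 : R) (T : R -> R) :
  affine_copy T 0 x1 0 y1 ->
  affine_copy T x1 (x2 - x1) y1 (y2 - y1) ->
  affine_copy T x2 (1 - x2) y2 (1 - y2) ->
  0 < y2 -> y1 < 1 -> x1 < y1 -> x2 - x1 < y1 - y2 -> y2 < x2 ->
  exists2 b, 0 < b < 1 & forall e, 0 < e -> exists u h v g,
    [/\ affine_copy T u h v g, g != 0 &
        forall t, 0 <= t <= 1 -> `|(u + h * t - v) / g - b| <= e].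
Proof.
move=> cp1 cp2 cp3 y20 y11 xy1 xy12 xy2.
have [d d0 boxes] := zipper_flat_copies cp1 cp2 cp3 y20 y11 xy1 xy12 xy2.
pose ok e (b : R) := exists u h v g,
    [/\ affine_copy T u h v (- g), 0 < g, h <= e * g & b = (v - u) / g].
have /choice[b bP] (n : nat) : exists b, d <= b <= 1 - d / 2 /\ ok n.+1%:R^-1 b.
  (* The bound [d / 2] on [h / g] keeps the starting level below 1, as the final level is at most
     [1 - d]. *)
  have e0 : 0 < Num.min (d / 2) n.+1%:R^-1 by rewrite lt_min invr_gt0 ltr0Sn; lra.
  have [u [h [v [g [cp g0 hg lo hi]]]]] := boxes _ e0.
  exists ((v - u) / g); split; last first.
    exists u, h, v, g; split=> //; apply: le_trans hg _.
    by rewrite ler_pM2r // ge_min lexx orbT.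
  rewrite ler_pdivlMr // mulrC lo ler_pdivrMr //=.
  have : h <= d / 2 * g by apply: le_trans hg _; rewrite ler_pM2r // ge_min lexx.
  by nra.
have [c []] : `[d, 1 - d / 2] `&` cluster (b @ \oo) !=set0.
  apply: segment_compact; exists 0%N => // n _ /=.
  by rewrite in_itv /=; have [] := bP n.
rewrite /= in_itv /= => cd cl; exists c; first by lra.
move=> e e0; have e20 : 0 < e / 2 by lra.
have [n _ nP] : \forall n \near \oo, n.+1%:R^-1 < e / 2.
  have /cvgrPdist_lt/(_ _ e20)[n _ nP] := @cvg_harmonic R.
  by exists n => // m /nP; rewrite sub0r normrN ger0_norm // invr_ge0.
have [y [[m nm bm] bc]] : (b @` [set j | (n <= j)%N])
    `&` ball c (e / 2) !=set0.
  apply: cl; last exact: nbhsx_ballx.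
  by exists n => // j nj; exists j.
have [_ [u [h [v [g [cp g0 hg bE]]]]]] := bP m.
exists u, h, v, (- g); split=> //; first by rewrite oppr_eq0 gt_eqF.
move=> t t01; have [h0 _ _ _] := cp.
have -> : (u + h * t - v) / - g = b m - h * t / g by rewrite bE; field; rewrite gt_eqF.
have : 0 <= h * t / g <= e / 2.
  have ht : 0 <= h * t <= h by nra.
  have hge : h <= e / 2 * g.
    by apply: le_trans hg _; rewrite ler_pM2r // ltW //; exact: nP.
  by rewrite ler_pdivrMr // divr_ge0 //=; lra.
by move: bc; rewrite -bm /ball /= ltr_norml ler_norml; lra.
Qed.

(** * The centrally symmetric case *)

(** A copy centred at (1/2, 1/2) has centred iterates, with ratios [h ^+ n] and [g ^+ n]; the
    diagonal passes through the common centre. *)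
Lemma symmetric_flat_copies (R : realType) (h g : R) (T : R -> R) :
  affine_copy T ((1 - h) / 2) h ((1 - g) / 2) g -> g != 0 -> h < `|g| ->
  forall e, 0 < e -> exists u h v g,
    [/\ affine_copy T u h v g, g != 0 &
        forall t, 0 <= t <= 1 -> `|(u + h * t - v) / g - 1 / 2| <= e].
Proof.
move=> cp g0 hg e e0; have [h0 _ h1 _] := cp.
have gn0 : 0 < `|g| by rewrite normr_gt0.
have [n qn] : exists n, (h / `|g|) ^+ n < e.
  by apply: exp_lt_small; rewrite // ?divr_ge0 ?ltr_pdivrMr ?mul1r // ltW.
exists ((1 - h ^+ n) / 2), (h ^+ n), ((1 - g ^+ n) / 2), (g ^+ n).
have gX0 : g ^+ n != 0 by rewrite expf_neq0.
split => //.
  elim: n {qn gX0} => [|n IH].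
    by rewrite !expr0 subrr mul0r; split; [lra..|move=> t _; rewrite !add0r !mul1r].
  have := affine_copy_comp IH cp; rewrite !exprSr.
  by congr affine_copy; field.
move=> t t01.
have -> : ((1 - h ^+ n) / 2 + h ^+ n * t - (1 - g ^+ n) / 2) / g ^+ n - 1 / 2 =
    (h / g) ^+ n * (t - 1 / 2) by rewrite expr_div_n; field.
rewrite normrM normrX normrM normfV (gtr0_norm h0).
have : `|t - 1 / 2| <= 1 by rewrite ler_norml; lra.
have : 0 <= (h / `|g|) ^+ n by rewrite exprn_ge0 // divr_ge0 // ltW.
by have := normr_ge0 (t - 1 / 2); nra.
Qed.

(** Renormalization fixes the level 1/2, and [g < 0] puts [v] above it, so every pass through the
    copy adds a branch. *)
Lemma symmetric_multiplicity (R : realType) (u h v g : R) (T : R -> R) N :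
  C00 T -> affine_copy T u h v g -> g != 0 -> v = (1 - g) / 2 -> g < 0 ->
  multiplicity_ge T N (1 / 2).
Proof.
move=> CT cp g0 vE gn; elim: N => [|N IH]; first exact: multiplicity_ge0.
apply: (multiplicity_ge_succ CT cp g0); first by lra.
by have -> : (1 / 2 - v) / g = 1 / 2 by rewrite vE; field.
Qed.

Theorem corollary2 (R : realType) (x1 y1 x2 y2 : R) (T : R -> R)
  (hx1 : 0 < x1 < 1) (hy1 : 0 < y1 < 1) (hx2 : 0 < x2 < 1) (hy2 : 0 < y2 < 1)
  (hx : x1 < x2) (hy : y2 < y1)
  (hT : is_zipper_map ((x1, y1), (x2, y2)) T)
  (hyper : 1 < Num.min (y1 / x1)
                 (Num.min ((y1 - y2) / (x2 - x1)) ((1 - y2) / (1 - x2))))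
  (hcond : (x1 + x2 = 1 /\ y1 + y2 = 1) \/
           (y2 < y1 ^+ 2 /\ (2 - y2) * y2 < y1))
  (k l : nat) (hk : (0 < k)%N) (hl : (0 < l)%N)
  (prec : rel ('I_k * 'I_l.+1)) (hprec : strict_total_order prec) :
  exists z : 'I_k -> R,
    (forall i : 'I_k, 0 <= z i <= 1) /\
    (forall (i i' : 'I_k) (j j' : 'I_l.+1),
       prec (i, j) (i', j') <-> iter j T (z i) < iter j' T (z i')).
Proof.
have [[x10 x11] [y10 y11]] := (andP hx1, andP hy1).
have [[x20 x21] [y20 y21]] := (andP hx2, andP hy2).
have [cp1 cp2 cp3] := is_zipper_map_copies x10 hx x21 hT.
have CT := hT.1.
move: hyper; rewrite !lt_min !ltr_pdivlMr ?subr_gt0 // !mul1r.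
move=> /and3P[xy1 xy12 xy2].
suff [K [K0 KI br]] : exists K : set R,
    [/\ K !=set0, K `<=` [set x | 0 <= x <= 1] &
      ordered_branches T (k * l.+1) K K].
  have [z [zK zP]] := orders_of_ordered_branches hprec K0 br.
  by exists z; split=> // i; exact: KI.
case: hcond => [[sx sy]|[c1 c2]].
  have g0 : y2 - y1 != 0 by rewrite subr_eq0 lt_eqF.
  have E1 : x1 = (1 - (x2 - x1)) / 2 by lra.
  have E2 : y1 = (1 - (y2 - y1)) / 2 by lra.
  apply: (@horseshoe_of_copies _ _ (1 / 2)).
    by apply: (symmetric_multiplicity _ CT cp2) => //; lra.
  apply: (@symmetric_flat_copies _ (x2 - x1) (y2 - y1)) => //.
    by rewrite -E1 -E2.
  by rewrite ltr0_norm; lra.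
have [|b b01 boxes] := zipper_crossing_level cp1 cp2 cp3 y20 y11 xy1 xy12.
  by lra.
apply: horseshoe_of_copies boxes.
exact: zipper_multiplicity CT cp1 cp2 cp3 y20 hy y11 c1 c2 b01.
Qed.
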